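(* Let $G=\bigcup_{s} G_s$ be a scaled group (with associated scaled vector space $\mathfrak g=\bigcup_s\mathfrak g_s$, local parametrization $\exp$ and constant $\kappa$) acting, by an action of a scaled group, on a scaled vector space $E=\bigcup_s E_s$. Suppose that the action satisfies condition $(A_c)$ for some $c\ge 1$, and that the linear map $$\rho:\mathfrak g\to E,\qquad \xi\mapsto \xi\, 0_E$$ has a right inverse $j:E\to\mathfrak g$ (a linear map with $\rho\circ j=\mathrm{id}_E$) which is $k$-bounded, $k\ge 0$. Then $E$ is locally $G$-homogeneous; more precisely, for every $s\in\,]0,1[$ and every $\delta\in\,]0,s[$ such that $\delta\le 4\,N(j)^{1/(k+1)}$, $$\varepsilon\, B^E_{s}\subset \exp\left(B^{\mathfrak g}_{s-\delta}\right) 0_E,\qquad\text{where}\quad \varepsilon=\frac{\delta^{2k+2}}{4^{3k+4}\,c\,N(j)^2}.$$ Here $\exp(B^{\mathfrak g}_{s-\delta})\,0_E=\{e^{\xi}\,0_E:\ \xi\in B^{\mathfrak g}_{s-\delta}\}$.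
   Context: Throughout, $s$ and $\sigma$ denote real numbers such that $\sigma>0$ and all the indices that occur ($s$, $s+\sigma$, $s+2\sigma$) lie in $]0,1[$. **Scaled vector space.** A vector space $E$ is scaled if it is the union of a decreasing family of subspaces $(E_s)_{s\in]0,1[}$, each a Banach space with norm $|\cdot|_s$, such that the inclusions $E_{s+\sigma}\subset E_s$, $\sigma>0$, have norm at most $1$. $B^E_s$ denotes the closed unit ball of $E_s$ centred at the origin, and $B^E=\bigcup_s B^E_s$. For $r>0$, $rB^E_s$ is the ball of radius $r$, and $rB^E=\bigcup_s rB^E_s$. $0_E$ denotes the origin of $E$. **$k$-bounded maps.** A linear map $u:E\to F$ between scaled vector spaces is $k$-bounded if it maps $E_{s+\sigma}$ into $F_s$ for all $s<s+\sigma$ and $$N(u):=\sup_{s<s+\sigma,\ x\in E_{s+\sigma}\setminus\{0\}}\sigma^k\,\frac{|u(x)|_s}{|x|_{s+\sigma}}<+\infty .$$ **Scaled manifold.** A topological manifold $X$ is scaled if it is equipped with a nested family of Banach differentiable manifolds $X_s\subset X$, $s\in]0,1[$, with $X_{s+\sigma}\subset X_s$, modelled on the members $E_s$ of a scaled vector space $E$. **Scaled group.** Let $G=\bigcup_s G_s$ be a set equipped with both a group structure and a structure of scaled manifold modelled on a scaled vector space $\mathfrak g=\bigcup_s\mathfrak g_s$ (the individual $G_s$ need not be groups). Let $$\exp:2B^{\mathfrak g}\to G,\quad \xi\mapsto e^\xi,\quad 0\mapsto 1$$ be a local parametrization of $G$ by a homeomorphism (onto its image) commuting with the inclusions of the scales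 (so $\exp$ maps $2B^{\mathfrak g}_s$ into $G_s$, compatibly in $s$), and let $\log$ be the left inverse of $\exp$. $G$ is a scaled group if there exists $\kappa>0$ such that the group law induces maps $$B^{\mathfrak g}_{s+\sigma}\times\sigma B^{\mathfrak g}_s\to\exp\left((1+\sigma)B^{\mathfrak g}_s\right)\subset G_s,\quad(\xi,\eta)\mapsto e^\xi e^\eta$$ satisfying, for all $\xi\in B^{\mathfrak g}_{s+2\sigma}$ and $\eta\in\sigma B^{\mathfrak g}_s$, $$|\log(e^\xi e^\eta)|_s\le|\xi|_{s+\sigma}+|\eta|_s,\qquad |\log(e^\xi e^\eta)-\xi-\eta|_s\le\kappa\,\sigma^{-1}|\xi|_{s+2\sigma}|\eta|_s .$$ **Action of a scaled group.** An action of a scaled group $G$ on a scaled vector space $E$ is an action of the group $G$ on $E$ which induces maps of class $C^1$ $$(\sigma B^{\mathfrak g}_s)\times E_{s+\sigma}\to E_s,\quad(\xi,x)\mapsto e^\xi x .$$ It induces an infinitesimal action of $\mathfrak g$: for every $\xi\in\mathfrak g_s$, $$\xi:E_{s+\sigma}\to E_s,\qquad \xi\,x:=\left.\frac{d}{dt}\right|_{t=0}\left(e^{t\xi}x\right).$$ **Condition $(A_c)$.** For $c\ge1$, the action satisfies condition $(A_c)$ if for all $s,\sigma$ and all $\xi\in B^{\mathfrak g}_{s+2\sigma}$, $$\left|(e^\xi)^{-1}(\xi\,0_E)\right|_s\le c\,\sigma^{-1}|\xi|_{s+2\sigma}^2 ,$$ where $(e^\xi)^{-1}(\xi\,0_E)$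 is the image of the vector $\xi\,0_E\in E$ under the action of the group element $(e^\xi)^{-1}$ (this includes that the image lies in $E_s$). *)

(* Defs.v *)
From HB Require Import structures.
From mathcomp Require Import all_boot all_order all_algebra.
From mathcomp Require Import all_classical all_reals all_analysis.
Import Order.TTheory GRing.Theory Num.Theory.
Import numFieldNormedType.Exports.

Set Implicit Arguments.
Unset Strict Implicit.
Unset Printing Implicit Defensive.

Local Open Scope classical_set_scope.
Local Open Scope ring_scope.

(* The subspace E_s is the image of the linear injection [sv_inj s] of the
   Banach space [sv_scale s] into E.  Only indices s in ]0,1[ are meaningful. *)
Record scaledVect (R : realType) := ScaledVect {
  sv_car :> lmodType R ;
  sv_scale : R -> completeNormedModType R ;
  sv_inj : forall s : R, {linear sv_scale s -> sv_car} ;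
  sv_inj_inj : forall s, 0 < s < 1 -> injective (sv_inj s) ;
  sv_decr : forall s sigma, 0 < s -> 0 < sigma -> s + sigma < 1 ->
    forall x : sv_scale (s + sigma),
      exists2 y : sv_scale s, sv_inj s y = sv_inj (s + sigma) x & `|y| <= `|x| ;
  sv_cover : forall x : sv_car,
    exists2 s, 0 < s < 1 & range (sv_inj s) x
}.

Section ScaledVectTheory.
Context {R : realType}.
Implicit Types E F : scaledVect R.

Definition sv_in E (s : R) : set E := range (sv_inj E s).

(* The inverse of [sv_inj E s] on E_s; its value off E_s is irrelevant. *)
Definition sv_lift E (s : R) (x : E) : sv_scale E s :=
  xget 0 [set y | sv_inj E s y = x].

Definition sv_norm E (s : R) (x : E) : R := `|sv_lift s x|.

Definition sv_ball E (s r : R) : set E :=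
  [set x | sv_in s x /\ sv_norm s x <= r].

Arguments sv_ball : clear implicits.

Definition sv_bigball E (r : R) : set E :=
  \bigcup_(s in [set s : R | 0 < s < 1]) sv_ball E s r.
Arguments sv_bigball : clear implicits.

(* For the zero space the set below is empty and [kN k u] is [sup set0 = 0]. *)
Definition k_quotients E F (k : R) (u : E -> F) : set R :=
  [set q | exists s sigma (x : E),
     [/\ 0 < s, 0 < sigma & s + sigma < 1] /\
     [/\ sv_in (s + sigma) x, x != 0
       & q = sigma `^ k * (sv_norm s (u x) / sv_norm (s + sigma) x)]].

Definition k_bounded E F (k : R) (u : E -> F) : Prop :=
  (forall s sigma, 0 < s -> 0 < sigma -> s + sigma < 1 ->
     forall x : E, sv_in (s + sigma) x -> sv_in s (u x)) /\
  has_ubound (k_quotients k u).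

Definition kN E F (k : R) (u : E -> F) : R := sup (k_quotients k u).

End ScaledVectTheory.
Arguments sv_ball {R} E s r.
Arguments sv_bigball {R} E r.

(* E with the direct limit topology of the Banach spaces E_s. *)
Definition dlim (R : realType) (E : scaledVect R) : Type := sv_car E.

Section DirectLimitTopology.
Context {R : realType} (E : scaledVect R).

Definition dlim_open : set (set (dlim E)) :=
  [set U | forall s, 0 < s < 1 -> open (sv_inj E s @^-1` U)].

Let dlim_openT : dlim_open setT.
Proof. by move=> s _; rewrite preimage_setT; exact: openT. Qed.

Let dlim_openI : setI_closed dlim_open.
Proof.
by move=> A B oA oB s hs; rewrite preimage_setI; apply: openI; [exact: oA | exact: oB].
Qed.

Let dlim_open_bigU (I : Type) (f : I -> set (dlim E)) :
  (forall i, dlim_open (f i)) -> dlim_open (\bigcup_i f i).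
Proof.
by move=> of_ s hs; rewrite preimage_bigcup; apply: bigcup_open => i _; exact: of_.
Qed.

HB.instance Definition _ := Choice.copy (dlim E) (sv_car E).
HB.instance Definition _ :=
  isOpenTopological.Build (dlim E) dlim_openT dlim_openI dlim_open_bigU.

End DirectLimitTopology.

(* C^1 on a set A that need not be open (e.g. a closed ball times a space):
   f has at each point of A a continuous linear derivative relative to A, which
   varies continuously on A in operator norm.  On open sets this is the usual
   notion. *)
Definition C1_on (R : realType) (V W : normedModType R) (A : set V) (f : V -> W) :=
  exists df : V -> {linear V -> W}, forall p, A p ->
    [/\ continuous (df p),
        forall e : R, 0 < e -> \forall q \near within A (nbhs p),
          `|f q - f p - df p (q - p)| <= e * `|q - p|
      & forall e : R, 0 < e -> \forall q \near within A (nbhs p),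
          forall h, `|df q h - df p h| <= e * `|h|].

(* [A] is a C^1 atlas on the subset [M] of [X], with charts (domain, coordinate
   map) in the Banach space [V]. *)
Definition banach_atlas (R : realType) (X : Type) (V : completeNormedModType R)
    (M : set X) (A : set (set X * (X -> V))) : Prop :=
  [/\ M = \bigcup_(c in A) c.1,
      forall c, A c -> set_inj c.1 c.2 /\ open (c.2 @` c.1)
    & forall c d, A c -> A d ->
        open (c.2 @` (c.1 `&` d.1)) /\
        exists tau : V -> V, C1_on (c.2 @` (c.1 `&` d.1)) tau /\
          forall x, c.1 x -> d.1 x -> tau (c.2 x) = d.2 x].

Definition topological_manifold (X Y : topologicalType) : Prop :=
  forall x : X, exists (U : set X) (phi : X -> Y) (psi : Y -> X),
    [/\ open U, U x & open (phi @` U)] /\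
    [/\ {within U, continuous phi}, {within phi @` U, continuous psi}
      & {in U, cancel phi psi}].

Record scaledManifold (R : realType) (E : scaledVect R) (X : topologicalType) :=
  ScaledManifold {
  sm_topological : topological_manifold X (dlim E) ;
  sm_scale : R -> set X ;
  sm_atlas : forall s : R, set (set X * (X -> sv_scale E s)) ;
  sm_atlasP : forall s, 0 < s < 1 -> banach_atlas (sm_scale s) (@sm_atlas s) ;
  sm_nested : forall s sigma, 0 < s -> 0 < sigma -> s + sigma < 1 ->
    sm_scale (s + sigma) `<=` sm_scale s
}.

(* A set with a group law and a topology, with no compatibility required. *)
#[short(type="groupWithTopologyType")]
HB.structure Definition GroupWithTopology := {T of Group T & Topological T}.

(* [sg_exp] and [sg_log] are total; only their restrictions to the ball of
   radius 2 and to its image are meaningful. *)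
Record scaledGroup (R : realType) := ScaledGroup {
  sg_car :> groupWithTopologyType ;
  sg_lie : scaledVect R ;
  sg_manifold : scaledManifold sg_lie sg_car ;
  sg_cover : \bigcup_(s in [set s : R | 0 < s < 1]) sm_scale sg_manifold s = setT ;
  sg_exp : sg_lie -> sg_car ;
  sg_log : sg_car -> sg_lie ;
  sg_exp0 : sg_exp 0 = 1%g ;
  sg_expK : {in sv_bigball sg_lie 2, cancel sg_exp sg_log} ;
  sg_exp_continuous :
    {within (sv_bigball sg_lie 2 : set (dlim sg_lie)),
       continuous (sg_exp : dlim sg_lie -> sg_car)} ;
  sg_log_continuous :
    {within sg_exp @` sv_bigball sg_lie 2,
       continuous (sg_log : sg_car -> dlim sg_lie)} ;
  sg_exp_nbhs : nbhs (1%g : sg_car) (sg_exp @` sv_bigball sg_lie 2) ;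
  sg_exp_scale : forall s, 0 < s < 1 ->
    sg_exp @` sv_ball sg_lie s 2 `<=` sm_scale sg_manifold s ;
  sg_mul_scale : forall s sigma, 0 < s -> 0 < sigma -> s + sigma < 1 ->
    forall xi eta : sg_lie, sv_ball sg_lie (s + sigma) 1 xi -> sv_ball sg_lie s sigma eta ->
      (sg_exp @` sv_ball sg_lie s (1 + sigma)) (sg_exp xi * sg_exp eta)%g ;
  sg_mul_estimates : exists2 kappa : R, 0 < kappa &
    forall s sigma, 0 < s -> 0 < sigma -> s + 2 * sigma < 1 ->
    forall xi eta : sg_lie, sv_ball sg_lie (s + 2 * sigma) 1 xi -> sv_ball sg_lie s sigma eta ->
      sv_norm s (sg_log (sg_exp xi * sg_exp eta)%g)
        <= sv_norm (s + sigma) xi + sv_norm s eta /\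
      sv_norm s (sg_log (sg_exp xi * sg_exp eta)%g - xi - eta)
        <= kappa * sigma^-1 * sv_norm (s + 2 * sigma) xi * sv_norm s eta
}.

Record scaledAction (R : realType) (G : scaledGroup R) (E : scaledVect R) :=
  ScaledAction {
  sa_act :> G -> E -> E ;
  sa_act1 : forall x, sa_act 1%g x = x ;
  sa_actM : forall g h x, sa_act (g * h)%g x = sa_act g (sa_act h x) ;
  sa_act_scale : forall s sigma, 0 < s -> 0 < sigma -> s + sigma < 1 ->
    forall (xi : sg_lie G) (x : E), sv_ball (sg_lie G) s sigma xi -> sv_in (s + sigma) x ->
      sv_in s (sa_act (sg_exp xi) x) ;
  sa_act_C1 : forall s sigma, 0 < s -> 0 < sigma -> s + sigma < 1 ->
    C1_on [set p : sv_scale (sg_lie G) s * sv_scale E (s + sigma) | `|p.1| <= sigma]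
      (fun p => sv_lift s
         (sa_act (sg_exp (sv_inj (sg_lie G) s p.1)) (sv_inj E (s + sigma) p.2)))
}.

Section ActionTheory.
Context {R : realType} {G : scaledGroup R} {E : scaledVect R}.
Variable a : scaledAction G E.

(* xi x is the derivative at t = 0, in the Banach space E_s, of e^{t xi} x, for
   any s, sigma with xi in g_s and x in E_{s+sigma}; it does not depend on the
   choice of s and sigma because the inclusions of the scales are continuous. *)
Definition inf_act (xi : sg_lie G) (x : E) : E :=
  xget 0 [set y : E | exists s sigma,
    [/\ 0 < s, 0 < sigma & s + sigma < 1] /\
    [/\ sv_in s xi, sv_in (s + sigma) x
      & exists2 w : sv_scale E s, y = sv_inj E s w &
          is_derive (0 : R) (1 : R)
            (fun t : R => sv_lift s (a (sg_exp (t *: xi)) x)) w]].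

Definition cond_A (c : R) : Prop :=
  forall s sigma, 0 < s -> 0 < sigma -> s + 2 * sigma < 1 ->
  forall xi : sg_lie G, sv_ball (sg_lie G) (s + 2 * sigma) 1 xi ->
    let y := a (sg_exp xi)^-1%g (inf_act xi 0) in
    sv_in s y /\ sv_norm s y <= c * sigma^-1 * sv_norm (s + 2 * sigma) xi ^+ 2.

(* The orbit of the origin contains a ball of every E_s. *)
Definition locally_homogeneous : Prop :=
  forall s, 0 < s < 1 ->
    exists2 r, 0 < r & sv_ball E s r `<=` range (fun g : G => a g 0).

End ActionTheory.

(* Main.v *)
Require Import Defs.
From mathcomp Require Import all_boot all_order all_algebra.
From mathcomp Require Import all_classical all_reals all_analysis.
From mathcomp Require Import ring lra.
Import Order.TTheory GRing.Theory Num.Theory.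
Import numFieldNormedType.Exports.
Local Open Scope classical_set_scope.
Local Open Scope ring_scope.

Set Implicit Arguments.
Unset Strict Implicit.
Unset Printing Implicit Defensive.

(** Newton's method on the group.  Starting from x_0 = x put xi_n = j x_n and
x_{n+1} = (e^{xi_n})^-1 x_n.  As rho (j x_n) = x_n, the vector x_{n+1} is
(e^{xi_n})^-1 (xi_n 0), so condition (A_c) bounds it by the square of xi_n: there is
no Taylor remainder to estimate.  Unwinding, x = e^{xi_0} ... e^{xi_n} x_{n+1}, and
it remains to let n tend to infinity.

The scales are spent geometrically.  Put u_n = delta 2^-n.  Step n gives up u_n / 4
for the k-bounded map j and 2 (u_n / 16) for (A_c), hence 3 delta / 4 in all.  With
N = N(j), the recursion is
  |x_{n+1}| <= c (u_n / 16)^-1 (N (u_n / 4)^-k |x_n|)^2,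
and the value of epsilon is what makes |x_n| <= epsilon 4^{-(k+1) n} propagate
(lemma newton_bounds).  The bound delta <= 4 N^{1/(k+1)} then gives
|xi_n| <= (delta / 64) 4^-n.

In the chart, eta_n = log (e^{xi_0} ... e^{xi_n}) is built one factor at a time, with
sigma = u_n / 8 in the group law.  The first estimate of the group law keeps
|eta_n| <= delta / 32, and the second one makes eta_n a Cauchy sequence in
g_{s - 3 delta / 4} (lemma log_prod_cvg).  Its limit eta is far smaller than the
delta / 4 of scale that is left, so the action
(delta / 4) B_{s - delta} x E_{s - 3 delta / 4} -> E_{s - delta} is continuous at
(eta, 0) and x = e^{eta_n} x_{n+1} passes to the limit as x = e^eta 0
(lemma act_limit). *)

(** * Calculus in a scaled vector space *)

Section ScaleCalculus.
Context {R : realType}.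
Implicit Types E : scaledVect R.

Lemma sv_injK E (s : R) (y : sv_scale E s) : 0 < s < 1 ->
  sv_lift s (sv_inj E s y) = y.
Proof.
move=> hs; apply: (sv_inj_inj hs).
exact: (@xgetPex _ 0 [set z | sv_inj E s z = sv_inj E s y] (ex_intro _ y erefl)).
Qed.

Lemma sv_liftK E (s : R) (x : E) : 0 < s < 1 -> sv_in s x ->
  sv_inj E s (sv_lift s x) = x.
Proof. by move=> hs [y _ <-]; rewrite sv_injK. Qed.

Lemma sv_norm_inj E (s : R) (y : sv_scale E s) : 0 < s < 1 ->
  sv_norm s (sv_inj E s y) = `|y|.
Proof. by move=> hs; rewrite /sv_norm sv_injK. Qed.

Lemma sv_in_inj E (s : R) (y : sv_scale E s) : sv_in s (sv_inj E s y).
Proof. by exists y. Qed.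

Lemma sv_in0 E (s : R) : sv_in s (0 : E).
Proof. by exists 0 => //; rewrite linear0. Qed.

Lemma sv_norm0 E (s : R) : 0 < s < 1 -> sv_norm s (0 : E) = 0.
Proof. by move=> hs; rewrite -(linear0 (sv_inj E s)) sv_norm_inj // normr0. Qed.

Lemma sv_norm_ge0 E (s : R) (x : E) : 0 <= sv_norm s x.
Proof. exact: normr_ge0. Qed.

Lemma sv_norm_gt0 E (s : R) (x : E) : 0 < s < 1 -> sv_in s x -> x != 0 ->
  0 < sv_norm s x.
Proof.
move=> hs [y _ <-] x0; rewrite sv_norm_inj // normr_gt0.
by apply: contraNneq x0 => ->; rewrite linear0.
Qed.

Lemma sv_liftB E (s : R) (x y : E) : 0 < s < 1 -> sv_in s x -> sv_in s y ->
  sv_lift s (x - y) = sv_lift s x - sv_lift s y.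
Proof.
by move=> hs [x' _ <-] [y' _ <-]; rewrite -linearB !sv_injK.
Qed.

Lemma sv_inB E (s : R) (x y : E) : sv_in s x -> sv_in s y -> sv_in s (x - y).
Proof.
by move=> [x' _ <-] [y' _ <-]; rewrite -linearB; exact: sv_in_inj.
Qed.

Lemma sv_normD E (s : R) (x y : E) : 0 < s < 1 -> sv_in s x -> sv_in s y ->
  sv_norm s (x + y) <= sv_norm s x + sv_norm s y.
Proof.
by move=> hs [x' _ <-] [y' _ <-]; rewrite -linearD !sv_norm_inj // ler_normD.
Qed.

Lemma sv_incl E (s t : R) (x : E) : 0 < s -> s <= t -> t < 1 -> sv_in t x ->
  sv_in s x /\ sv_norm s x <= sv_norm t x.
Proof.
move=> s0; rewrite le_eqVlt => /predU1P[<- //|st] t1.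
have d0 : 0 < t - s by lra.
have d1 : s + (t - s) < 1 by lra.
have -> : t = s + (t - s) by ring.
move=> [y _ <-]; have [z zy nzy] := sv_decr s0 d0 d1 y.
split; first by rewrite -zy; exact: sv_in_inj.
by rewrite -{1}zy !sv_norm_inj //; apply/andP; split; lra.
Qed.

Lemma sv_in_le E (s t : R) (x : E) : 0 < s -> s <= t -> t < 1 ->
  sv_in t x -> sv_in s x.
Proof. by move=> s0 st t1 /(sv_incl s0 st t1)[]. Qed.

Lemma sv_norm_le E (s t : R) (x : E) : 0 < s -> s <= t -> t < 1 ->
  sv_in t x -> sv_norm s x <= sv_norm t x.
Proof. by move=> s0 st t1 /(sv_incl s0 st t1)[]. Qed.

Lemma sv_ball_le E (s t r r' : R) : 0 < s -> s <= t -> t < 1 -> r <= r' ->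
  sv_ball E t r `<=` sv_ball E s r'.
Proof.
move=> s0 st t1 rr x [xt xr]; split; first exact: sv_in_le xt.
exact: le_trans (sv_norm_le _ _ _ xt) (le_trans xr rr).
Qed.

Lemma kN_ge0 E (F : scaledVect R) (k : R) (u : E -> F) : k_bounded k u -> 0 <= kN k u.
Proof.
move=> [_ hub]; rewrite /kN.
have [->|/set0P[q uq]] := eqVneq (k_quotients k u) set0; first by rewrite sup0.
apply: le_trans (ub_le_sup hub uq).
case: uq => s [sg [x [_ [_ _ ->]]]].
by rewrite mulr_ge0 ?powR_ge0 ?divr_ge0 ?sv_norm_ge0.
Qed.

(** The supremum defining the norm gives the usual bound; the quotients exclude x = 0,
for which both sides vanish. *)
Lemma kN_bound E (F : scaledVect R) (k : R) (u : {linear E -> F}) (s sigma : R) (x : E) :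
  k_bounded k u -> 0 < s -> 0 < sigma -> s + sigma < 1 -> sv_in (s + sigma) x ->
  sv_norm s (u x) <= kN k u / sigma `^ k * sv_norm (s + sigma) x.
Proof.
move=> bu s0 sg0 s1 hx.
have [->|x0] := eqVneq x 0; first by rewrite linear0 !sv_norm0 ?mulr0//; apply/andP; split; lra.
have nx : 0 < sv_norm (s + sigma) x by apply: sv_norm_gt0 => //; apply/andP; split; lra.
have sk : 0 < sigma `^ k by rewrite powR_gt0.
have : sigma `^ k * (sv_norm s (u x) / sv_norm (s + sigma) x) <= kN k u.
  by apply: ub_le_sup; [case: bu | exists s, sigma, x].
rewrite mulrC mulrAC ler_pdivrMr // => h.
by rewrite mulrAC ler_pdivlMr.
Qed.

End ScaleCalculus.

(** * Continuity of the action *)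

Section Action.
Context {R : realType}.

(** Near p, f differs from its affine approximation, which is continuous because df p is,
by at most |q - p|. *)
Lemma C1_on_cvg (V W : normedModType R) (A : set V) (f : V -> W) (p : V) :
  C1_on A f -> A p -> f @ within A (nbhs p) --> f p.
Proof.
move=> [df /[apply] -[cdf fdf _]].
have subp : q - p @[q --> within A (nbhs p)] --> (0 : V).
  apply: (@cvg_trans _ ((fun q => q - p) @ nbhs p)); first exact/cvg_app/cvg_within.
  by rewrite -(subrr p); apply: cvgB; [exact: cvg_id | exact: cvg_cst].
have dfp : f p + df p (q - p) @[q --> within A (nbhs p)] --> f p.
  rewrite -[X in _ --> X]addr0 -(linear0 (df p)).
  by apply: cvgD; [exact: cvg_cst | apply: continuous_cvg => //; exact: cdf].
have rem : f q - f p - df p (q - p) @[q --> within A (nbhs p)] --> (0 : W).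
  apply/cvgr0Pnorm_le => e e0; near=> q.
  have : `|f q - f p - df p (q - p)| <= 1 * `|q - p| by near: q; exact: fdf.
  rewrite mul1r => /le_trans; apply.
  by near: q; move/cvgr0Pnorm_le : subp; apply.
have := cvgD dfp rem; rewrite addr0 (@eq_cvg _ _ _ _ f) => [|q]; first exact.
change ((f p + df p (q - p)) + (f q - f p - df p (q - p)) = f q).
by rewrite -addrA !subrKC.
Unshelve. all: by end_near. Qed.

(** The action sigma B_s x E_{s + sigma} -> E_s is C^1, hence continuous, so its constant
value z along the sequence is also its value at the limit point. *)
Lemma act_limit (G : scaledGroup R) (E : scaledVect R) (a : scaledAction G E)
    (s sigma : R) (eta : nat -> sg_lie G) (l : sg_lie G) (y : nat -> E) (y' z : E) :
  0 < s -> 0 < sigma -> s + sigma < 1 ->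
  (forall n, sv_ball (sg_lie G) s sigma (eta n)) -> sv_ball (sg_lie G) s sigma l ->
  (forall n, sv_in (s + sigma) (y n)) -> sv_in (s + sigma) y' ->
  sv_norm s (eta n - l) @[n --> \oo] --> (0 : R) ->
  sv_norm (s + sigma) (y n - y') @[n --> \oo] --> (0 : R) ->
  (forall n, a (sg_exp (eta n)) (y n) = z) ->
  a (sg_exp l) y' = z.
Proof.
move=> s0 sg0 s1 heta hl hy hy' etal yy' az.
have hs : 0 < s < 1 by apply/andP; split; lra.
have hsg : 0 < s + sigma < 1 by apply/andP; split; lra.
have az_in : sv_in s z.
  by rewrite -(az 0%N); exact: (sa_act_scale a s0 sg0 s1 (heta 0%N) (hy 0%N)).
have al_in : sv_in s (a (sg_exp l) y') by exact: (sa_act_scale a s0 sg0 s1 hl hy').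
have := sa_act_C1 a s0 sg0 s1.
set A := [set _ | _]; set f := (fun _ => _) => fC1.
pose q n := (sv_lift s (eta n), sv_lift (s + sigma) (y n)).
pose p := (sv_lift s l, sv_lift (s + sigma) y').
have fE e x : sv_in s e -> sv_in (s + sigma) x ->
    f (sv_lift s e, sv_lift (s + sigma) x) = sv_lift s (a (sg_exp e) x).
  by move=> he hx; rewrite /f /= !sv_liftK.
have Ap : A p by rewrite /A /=; case: hl.
have Aq n : A (q n) by rewrite /A /=; case: (heta n).
have qp : q n @[n --> \oo] --> p.
  have liftC t (F : scaledVect R) (u : nat -> F) (v : F) :
      0 < t < 1 -> (forall n, sv_in t (u n)) ->
      sv_in t v -> sv_norm t (u n - v) @[n --> \oo] --> (0 : R) ->
      sv_lift t (u n) @[n --> \oo] --> sv_lift t v.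
    move=> ht hu hv uv; apply/subr_cvg0/norm_cvg0P.
    by under eq_cvg => n do rewrite -sv_liftB //.
  apply: cvg_pair; last exact: liftC.
  by apply: liftC => //; [move=> n; case: (heta n) | case: hl].
have qpA : q n @[n --> \oo] --> within A (nbhs p).
  move=> P AP; apply: (@filterS _ \oo _ _ _ _ (qp _ AP)) => n; exact.
have fq : f (q n) @[n --> \oo] --> f p.
  exact: cvg_comp qpA (C1_on_cvg fC1 Ap).
have fqz : (fun n => f (q n)) = fun=> sv_lift s z.
  by apply/funext => n; rewrite /q fE ?az //; case: (heta n).
rewrite -(sv_liftK hs az_in) -[LHS](sv_liftK hs al_in); congr (sv_inj E s _).
rewrite -fE; [|by case: hl|by []].
by apply: (norm_cvg_unique fq); rewrite fqz; exact: cvg_cst.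
Qed.

End Action.

(** * Infinite products in a scaled group *)

Section InfiniteProducts.
Context {R : realType}.

(** The product falls in the image of the ball of radius 1 + sigma <= 2, where log
inverts exp on both sides. *)
Lemma sg_mul_log (G : scaledGroup R) (s sigma : R) (xi eta : sg_lie G) :
  0 < s -> 0 < sigma -> s + sigma < 1 ->
  sv_ball (sg_lie G) (s + sigma) 1 xi -> sv_ball (sg_lie G) s sigma eta ->
  sv_in s (sg_log (sg_exp xi * sg_exp eta)%g) /\
  sg_exp (sg_log (sg_exp xi * sg_exp eta)%g) = (sg_exp xi * sg_exp eta)%g.
Proof.
move=> s0 sg0 s1 hxi heta.
have [z [zs zn] <-] := sg_mul_scale s0 sg0 s1 hxi heta.
rewrite sg_expK // inE; exists s => /=; first by apply/andP; split; lra.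
by split=> //; lra.
Qed.

Lemma half_pow_gt0 n : 0 < 2^-1 ^+ n :> R.
Proof. by rewrite exprn_gt0 // invr_gt0. Qed.

Lemma half_pow_le1 n : 2^-1 ^+ n <= 1 :> R.
Proof. by rewrite exprn_ile1 //; lra. Qed.

Lemma geometric_cauchy_cvg (V : completeNormedModType R) (u : nat -> V) (C : R) :
  (forall n, `|u n.+1 - u n| <= C * 2^-1 ^+ n) -> cvg (u n @[n --> \oo]).
Proof.
move=> hu.
have C0 : 0 <= C by have := hu 0%N; rewrite expr0 mulr1; apply: le_trans.
have -> : u = (fun n => u 0%N + series (telescope u) n).
  by apply/funext => n; rewrite -eq_sum_telescope.
apply: is_cvgD; first exact: is_cvg_cst.
apply: normed_cvg; apply: (@series_le_cvg _ _ (geometric C 2^-1)) => //=.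
- by move=> n; rewrite mulr_ge0 // ltW // half_pow_gt0.
- by apply: is_cvg_geometric_series; rewrite ger0_norm; lra.
Qed.

(** The second estimate of the group law, with its constant made a parameter so that
one constant serves for all the factors of a product. *)
Definition mul_defect_le (G : scaledGroup R) (kappa : R) : Prop :=
  forall s sigma, 0 < s -> 0 < sigma -> s + 2 * sigma < 1 ->
  forall xi eta : sg_lie G, sv_ball (sg_lie G) (s + 2 * sigma) 1 xi ->
    sv_ball (sg_lie G) s sigma eta ->
    sv_norm s (sg_log (sg_exp xi * sg_exp eta)%g - xi - eta)
      <= kappa * sigma^-1 * sv_norm (s + 2 * sigma) xi * sv_norm s eta.

Section Product.
Variables (G : scaledGroup R) (xi : nat -> sg_lie G).

Fixpoint log_prod n : sg_lie G :=
  if n is m.+1 then sg_log (sg_exp (log_prod m) * sg_exp (xi m.+1))%g else xi 0%N.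

(** The group law is used with sigma = (h 2^-n) / 4, so that 2 sigma is exactly the gap
between the scales of rank n and n + 1.  The radius
(h / 16) (1 - 4^-n / 4) grows at each step by more than the next factor
(h / 32) 4^-(n+1).  In the last clause, 1 / sigma costs only a factor 2^n against the
4^-n of that factor. *)
Lemma log_prod_step (r h : R) n : 0 < r -> 0 < h -> r + h < 1 ->
  sv_ball (sg_lie G) (r + h * 2^-1 ^+ n.+1) (h / 32 * (2^-1 ^+ n.+1) ^+ 2) (xi n.+1) ->
  sv_ball (sg_lie G) (r + h * 2^-1 ^+ n)
    (h / 16 * (1 - (2^-1 ^+ n) ^+ 2 / 4)) (log_prod n) ->
  [/\ sg_exp (log_prod n.+1) = (sg_exp (log_prod n) * sg_exp (xi n.+1))%g,
      sv_ball (sg_lie G) (r + h * 2^-1 ^+ n.+1)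
        (h / 16 * (1 - (2^-1 ^+ n.+1) ^+ 2 / 4)) (log_prod n.+1)
    & forall kappa : R, 0 < kappa -> mul_defect_le G kappa ->
     sv_norm r (log_prod n.+1 - log_prod n) <= (1 + kappa) * h * 2^-1 ^+ n].
Proof.
move=> r0 h0 rh1; move: (half_pow_gt0 n) (half_pow_le1 n); rewrite exprS.
have [p ->] : exists p : R, 2^-1 ^+ n = p by eexists.
move=> p0 p1 hxi hlog.
have [t tE'] : exists t : R, t = r + h * p / 2 by eexists.
have [sg sgE] : exists sg : R, sg = h * p / 4 by eexists.
have tE2 : r + h * (2^-1 * p) = t by rewrite tE'; field.
rewrite tE2 in hxi *.
have hp : 0 < h * p by rewrite mulr_gt0.
have hp1 : h * p <= h by rewrite ler_piMr // ltW.
have hpp : 0 < h * p ^+ 2 by rewrite mulr_gt0 // exprn_gt0.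
have hpp1 : h * p ^+ 2 <= h * p by rewrite expr2 mulrA ler_piMr // ltW.
have tE : r + h * p = t + 2 * sg by rewrite tE' sgE; field.
have sg0 : 0 < sg by rewrite sgE; lra.
have t0 : 0 < t by rewrite tE'; lra.
have t1 : t + 2 * sg < 1 by rewrite -tE; lra.
have rt : r <= t by rewrite tE'; lra.
have xiE : h / 32 * (2^-1 * p) ^+ 2 = h * p ^+ 2 / 128 by field.
have logE (q : R) : h / 16 * (1 - q / 4) = h / 16 - h * q / 64 by field.
have prodE : h * (2^-1 * p) ^+ 2 = h * p ^+ 2 / 4 by field.
rewrite xiE in hxi; rewrite tE logE in hlog; rewrite logE prodE.
have xi_sg : sv_ball (sg_lie G) t sg (xi n.+1).
  by apply: sv_ball_le hxi => //; lra.
have log1 : sv_ball (sg_lie G) (t + 2 * sg) 1 (log_prod n).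
  by apply: sv_ball_le hlog => //; lra.
have log1' : sv_ball (sg_lie G) (t + sg) 1 (log_prod n).
  by apply: sv_ball_le log1 => //; lra.
have t1' : t + sg < 1 by lra.
have [in_t expE] := sg_mul_log t0 sg0 t1' log1' xi_sg.
split=> // [|kappa k0 hk].
  split=> //=.
  have [_ _ /(_ _ _ t0 sg0 t1 _ _ log1 xi_sg)[+ _]] := sg_mul_estimates G.
  move=> /le_trans; apply.
  have : sv_norm (t + sg) (log_prod n) <= sv_norm (t + 2 * sg) (log_prod n).
    by apply: sv_norm_le; [lra|lra|lra|case: hlog].
  case: hlog => _; case: hxi => _; lra.
have := hk _ _ t0 sg0 t1 _ _ log1 xi_sg.
set d := _ - log_prod n - _ => hd.
have hr : 0 < r < 1 by apply/andP; split; lra.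
have log_t : sv_in t (log_prod n) by apply: sv_in_le (log1.1); lra.
have xi_t : sv_in t (xi n.+1) by case: hxi.
have d_t : sv_in t d by apply: sv_inB => //; exact: sv_inB.
have r_le (x : sg_lie G) : sv_in t x -> sv_in r x /\ sv_norm r x <= sv_norm t x.
  by apply: sv_incl => //; lra.
have -> : log_prod n.+1 - log_prod n = d + xi n.+1 by rewrite subrK.
apply: le_trans (sv_normD hr (r_le _ d_t).1 (r_le _ xi_t).1) _.
have := (r_le _ d_t).2; have := (r_le _ xi_t).2; move: hlog.2 hxi.2.
move: hd; rewrite -mulrA => hd nlog nxi nxr ndr.
have nlog0 := sv_norm_ge0 (t + 2 * sg) (log_prod n).
have nxi0 := sv_norm_ge0 t (xi n.+1).
have : sv_norm (t + 2 * sg) (log_prod n) * sv_norm t (xi n.+1)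
    <= (h / 16) * (h * p ^+ 2 / 128) by apply: ler_pM => //; lra.
move/(ler_wpM2l (x := kappa * sg^-1)) => /(_ _)/(le_trans hd) hd'.
have : sv_norm t d <= kappa * (h * p).
  apply: le_trans (hd' _) _; first by rewrite mulr_ge0 ?invr_ge0 ?ltW.
  have -> : kappa / sg * (h / 16 * (h * p ^+ 2 / 128)) = kappa * (h * p) / 512.
    by rewrite sgE; field; rewrite !gt_eqF.
  have := mulr_gt0 k0 hp; lra.
have := mulr_gt0 k0 hp; lra.
Qed.

End Product.

(** The scale r + h 2^-n of the n-th factor decreases to r, where the partial products
form a Cauchy sequence; completeness of g_r gives the limit. *)
Lemma log_prod_cvg (G : scaledGroup R) (xi : nat -> sg_lie G) (r h : R) :
  0 < r -> 0 < h -> r + h < 1 ->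
  (forall n, sv_ball (sg_lie G) (r + h * 2^-1 ^+ n)
               (h / 32 * (2^-1 ^+ n) ^+ 2) (xi n)) ->
  [/\ forall n, sg_exp (log_prod xi n.+1) =
                (sg_exp (log_prod xi n) * sg_exp (xi n.+1))%g,
      forall n, sv_ball (sg_lie G) r (h / 16) (log_prod xi n)
    & exists2 l, sv_ball (sg_lie G) r (h / 16) l
        & sv_norm r (log_prod xi n - l) @[n --> \oo] --> (0 : R)].
Proof.
move=> r0 h0 rh1 hxi.
have ball n : sv_ball (sg_lie G) (r + h * 2^-1 ^+ n)
    (h / 16 * (1 - (2^-1 ^+ n) ^+ 2 / 4)) (log_prod xi n).
  elim: n => [|n IH]; last by have [] := log_prod_step r0 h0 rh1 (hxi n.+1) IH.
  have := hxi 0%N; rewrite expr0 mulr1 expr1n mulr1 => -[? ?].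
  by split=> //; lra.
have ball_r n : sv_ball (sg_lie G) r (h / 16) (log_prod xi n).
  have p0 := half_pow_gt0 n; have p1 := half_pow_le1 n.
  have hp1 : h * 2^-1 ^+ n <= h by rewrite ler_piMr // ltW.
  have hp0 : 0 < h * 2^-1 ^+ n by rewrite mulr_gt0.
  apply: (sv_ball_le r0 _ _ _ (ball n)); [lra|lra|].
  apply: ler_piMr; first lra.
  by rewrite gerBl divr_ge0 // exprn_ge0 // ltW.
have hr : 0 < r < 1 by apply/andP; split; lra.
split=> // [n|]; first by have [] := log_prod_step r0 h0 rh1 (hxi n.+1) (ball n).
have [kappa k0 hk] := sg_mul_estimates G.
have defect : mul_defect_le G kappa.
  by move=> t sg t0 sg0 t1 x y hx hy; have [] := hk t sg t0 sg0 t1 x y hx hy.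
have : cvg (sv_lift r (log_prod xi n) @[n --> \oo]).
  apply: (geometric_cauchy_cvg (C := (1 + kappa) * h)) => n.
  rewrite -sv_liftB //; [|by case: (ball_r n.+1)|by case: (ball_r n)].
  by have [_ _] := log_prod_step r0 h0 rh1 (hxi n.+1) (ball n); apply.
set u := fun n => sv_lift r (log_prod xi n).
move=> /cvg_ex[l ul]; exists (sv_inj (sg_lie G) r l).
  split; first exact: sv_in_inj.
  rewrite sv_norm_inj //; apply: cvgr_to_le (cvg_norm ul) _.
  by apply: nearW => n; case: (ball_r n).
rewrite (@eq_cvg _ _ _ _ (fun n => `|u n - l|)).
  by apply/norm_cvg0P/subr_cvg0.
move=> n; rewrite /sv_norm sv_liftB // ?sv_injK //; first by case: (ball_r n).
exact: sv_in_inj.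
Qed.

End InfiniteProducts.

(** * The Newton iteration *)

Section NewtonIteration.
Context {R : realType}.

Section Newton.
Variables (G : scaledGroup R) (E : scaledVect R) (a : scaledAction G E).
Variables (c k : R) (j : {linear E -> sg_lie G}).

(** The residual left after n factors have been peeled off x. *)
Fixpoint newton (x : E) n : E :=
  if n is m.+1 then a (sg_exp (j (newton x m)))^-1%g (newton x m) else x.

(** The quadratic step: since rho (j x) = x, the new residual is the vector
(e^xi)^-1 (xi 0) that condition (A_c) controls.  The loss tau is spent on j and
2 sigma on (A_c). *)
Lemma newton_step (s sigma tau : R) (x : E) (A : R) :
  cond_A a c -> cancel j (fun xi : sg_lie G => inf_act a xi 0) -> k_bounded k j ->
  0 < s -> 0 < sigma -> 0 < tau -> s + 2 * sigma + tau < 1 -> 0 <= c ->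
  sv_in (s + 2 * sigma + tau) x ->
  kN k j / tau `^ k * sv_norm (s + 2 * sigma + tau) x <= A -> A <= 1 ->
  sv_ball (sg_lie G) (s + 2 * sigma) A (j x) /\
  sv_ball E s (c * sigma^-1 * A ^+ 2) (a (sg_exp (j x))^-1%g x).
Proof.
move=> hA hj hjk s0 sg0 tau0 s1 c0 hx xA A1.
have s2 : 0 < s + 2 * sigma by lra.
have jx_in : sv_in (s + 2 * sigma) (j x) by exact: (hjk.1 _ _ s2 tau0 s1 _ hx).
have jx : sv_ball (sg_lie G) (s + 2 * sigma) A (j x).
  by split=> //; apply: le_trans (kN_bound hjk s2 tau0 s1 hx) xA.
split=> //.
have s21 : s + 2 * sigma < 1 by lra.
have jx1 : sv_ball (sg_lie G) (s + 2 * sigma) 1 (j x).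
  by split=> //; case: jx => _; lra.
have /= := hA _ _ s0 sg0 s21 _ jx1; rewrite hj => -[? le1]; split=> //.
apply: le_trans le1 _; apply: ler_wpM2l; first by rewrite mulr_ge0 ?invr_ge0 // ltW.
by rewrite ler_sqr ?nnegrE ?sv_norm_ge0 //; [case: jx | apply: le_trans jx.2; exact: sv_norm_ge0].
Qed.

(** Telescoping: the factor e^{xi_{n+1}} undoes the passage from x_{n+1} to x_{n+2}. *)
Lemma newton_act (x : E) n :
  (forall n, sg_exp (log_prod (j \o newton x) n.+1) =
     (sg_exp (log_prod (j \o newton x) n) * sg_exp (j (newton x n.+1)))%g) ->
  a (sg_exp (log_prod (j \o newton x) n)) (newton x n.+1) = x.
Proof.
move=> expS; elim: n => [|n IH].
  by rewrite /= -sa_actM mulgV sa_act1.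
by rewrite expS sa_actM -[in RHS]IH /= -[in X in a _ X]sa_actM mulgV sa_act1.
Qed.

End Newton.

Lemma powR_half_sqr (x k : R) : 0 <= x -> ((2^-1 * x) `^ k) ^+ 2 * 4 `^ k = (x `^ k) ^+ 2.
Proof.
move=> x0; rewrite !expr2 -!powRM ?mulr_ge0 //.
by congr (_ `^ _); field.
Qed.

Lemma powR_quarter (x k : R) : 0 <= x -> (x / 4) `^ k = x `^ k / 4 `^ k.
Proof.
move=> x0; apply: (mulIf (x := 4 `^ k)); first by rewrite gt_eqF // powR_gt0.
rewrite mulfVK ?gt_eqF ?powR_gt0 // -powRM ?divr_ge0 //.
by congr (_ `^ _); field.
Qed.

(** The smallness condition on delta in the form in which it bounds the first
Newton correction. *)
Lemma powR_le_root (x N k : R) : 0 <= k -> 0 < x -> 0 < N ->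
  x <= 4 * N `^ (k + 1)^-1 -> x `^ k * x <= 4 * 4 `^ k * N.
Proof.
move=> k0 x0 N0 xN.
have k1 : 0 < k + 1 by lra.
have -> : x `^ k * x = x `^ (k + 1).
  by rewrite powRD ?powRr1 ?ltW // gt_eqF //; apply/implyP.
have -> : 4 * 4 `^ k * N = (4 * N `^ (k + 1)^-1) `^ (k + 1).
  rewrite powRM ?powR_ge0 // -powRrM mulVf ?gt_eqF // powRr1 ?ltW //.
  by rewrite powRD ?powRr1 // ?(mulrC 4) //; apply/implyP => _; rewrite gt_eqF.
by apply: ge0_ler_powR => //; rewrite ?nnegrE ?mulr_ge0 ?powR_ge0 // ltW.
Qed.

Lemma eps_expand (d k c N : R) : 0 <= k -> 0 < d ->
  d `^ (2 * k + 2) / (4 `^ (3 * k + 4) * c * N ^+ 2) =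
  (d `^ k * d) ^+ 2 / ((4 `^ k) ^+ 3 * 256 * c * N ^+ 2).
Proof.
move=> k0 d0.
have P (x : R) : 0 < x -> forall y n, x `^ (y + n%:R) = x `^ y * x ^+ n.
  by move=> x0 y n; rewrite powRD ?powR_mulrn ?ltW //; apply/implyP => _; rewrite gt_eqF.
have Q (x : R) n : 0 < x -> x `^ (n%:R * k) = (x `^ k) ^+ n.
  by move=> x0; rewrite mulrC powRrM powR_mulrn // powR_ge0.
rewrite !P // !Q //; congr (_ / (_ * _ * _ * _)); last by ring.
by rewrite exprMn.
Qed.

(** With p = 2^-n, step n spends d p / 4 on j and 2 (d p / 16) on (A_c).  The residual
decays like p^2 (p^k)^2 = 4^{-(k+1) n}: one factor p^k compensates the loss (d p / 4)^-k
of j, which leaves at least the decay p^2 for xi_n, and the step is stable because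
epsilon c N^2 = (d^{k+1})^2 / (256 4^{3k}). *)
Lemma newton_bounds (G : scaledGroup R) (E : scaledVect R) (a : scaledAction G E)
    (c k : R) (j : {linear E -> sg_lie G}) (s d : R) (x : E) :
  1 <= c -> cond_A a c -> 0 <= k ->
  cancel j (fun xi : sg_lie G => inf_act a xi 0) -> k_bounded k j ->
  s < 1 -> 0 < d -> d < s -> 0 < kN k j -> d <= 4 * kN k j `^ (k + 1)^-1 ->
  let eps := d `^ (2 * k + 2) / (4 `^ (3 * k + 4) * c * kN k j ^+ 2) in
  sv_ball E s eps x -> forall n,
  sv_ball E (s - 3 / 4 * d + 3 / 4 * (d * 2^-1 ^+ n))
    (eps * (2^-1 ^+ n) ^+ 2 * ((2^-1 ^+ n) `^ k) ^+ 2) (newton a j x n) /\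
  sv_ball (sg_lie G) (s - 3 / 4 * d + d / 2 * 2^-1 ^+ n)
    (d / 2 / 32 * (2^-1 ^+ n) ^+ 2) (j (newton a j x n)).
Proof.
move=> c1 hA k0 hj hjk s1 d0 ds N0 dN; set N := kN k j in N0 dN *.
move=> eps hx.
have DN := powR_le_root k0 d0 N0 dN.
have D0 : 0 < d `^ k by rewrite powR_gt0.
have F0 : 0 < 4 `^ k :> R by rewrite powR_gt0.
have F1 : 1 <= 4 `^ k :> R.
  have F00 : 1 <= 4 :> R by rewrite ler1n.
  by have := ler_powR F00 k0; rewrite powRr0.
have c0 : 0 < c by lra.
have epsE : eps = (d `^ k * d) ^+ 2 / ((4 `^ k) ^+ 3 * 256 * c * N ^+ 2).
  exact: eps_expand.
clearbody eps.
have eps0 : 0 < eps.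
  by rewrite epsE; apply: divr_gt0; rewrite !(mulr_gt0, exprn_gt0).
(* The bound of xi_0; that of xi_n has the further factor p^2 p^k. *)
have xi_le : N * 4 `^ k * eps / d `^ k <= d / 64.
  have -> : N * 4 `^ k * eps / d `^ k =
      (d `^ k * d) * (d / (256 * (4 `^ k) ^+ 2 * c * N)).
    by rewrite epsE; field; rewrite !gt_eqF.
  have -> : d / 64 = (4 * 4 `^ k * N) * (d / (256 * 4 `^ k * N)).
    by field; rewrite !gt_eqF.
  apply: ler_pM => //.
  - by rewrite mulr_ge0 // ltW.
  - by rewrite divr_ge0 ?mulr_ge0 ?exprn_ge0 // ltW.
  apply: ler_wpM2l; first exact: ltW.
  rewrite lef_pV2 ?posrE ?mulr_gt0 ?exprn_gt0 //.
  have -> : 256 * (4 `^ k) ^+ 2 * c * N = 256 * 4 `^ k * N * (4 `^ k * c) by ring.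
  by rewrite ler_peMr ?mulr_ge0 ?mulr_ege1 // ltW.
suff step n : sv_ball E (s - 3 / 4 * d + 3 / 4 * (d * 2^-1 ^+ n))
    (eps * (2^-1 ^+ n) ^+ 2 * ((2^-1 ^+ n) `^ k) ^+ 2) (newton a j x n) ->
  sv_ball (sg_lie G) (s - 3 / 4 * d + d / 2 * 2^-1 ^+ n)
    (d / 2 / 32 * (2^-1 ^+ n) ^+ 2) (j (newton a j x n)) /\
  sv_ball E (s - 3 / 4 * d + 3 / 4 * (d * 2^-1 ^+ n.+1))
    (eps * (2^-1 ^+ n.+1) ^+ 2 * ((2^-1 ^+ n.+1) `^ k) ^+ 2) (newton a j x n.+1).
  have H n : sv_ball E (s - 3 / 4 * d + 3 / 4 * (d * 2^-1 ^+ n))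
      (eps * (2^-1 ^+ n) ^+ 2 * ((2^-1 ^+ n) `^ k) ^+ 2) (newton a j x n).
    elim: n => [|n /step[] //].
    by rewrite expr0 powR1 !expr1n !mulr1 subrK.
  by move=> n; split=> //; have [] := step _ (H n).
move: (half_pow_gt0 (R := R) n) (half_pow_le1 (R := R) n); rewrite (exprS 2^-1 n).
have [p ->] : exists p : R, 2^-1 ^+ n = p by eexists.
move=> p0 p1 [xin xle].
have [q qE] : exists q : R, q = p `^ k by eexists.
have [q' q'E] : exists q : R, q = (2^-1 * p) `^ k by eexists.
rewrite -qE in xle *; rewrite -q'E.
have q0 : 0 < q by rewrite qE powR_gt0.
have q1 : q <= 1.
  by rewrite qE; have := ge0_ler_powR k0 (ltW p0) ler01 p1; rewrite powR1; apply; rewrite nnegrE ltW.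
have qq : q' ^+ 2 = q ^+ 2 / 4 `^ k.
  by rewrite qE q'E -(powR_half_sqr k (ltW p0)) mulfK // gt_eqF.
have dp0 : 0 < d * p by rewrite mulr_gt0.
have dp1 : d * p <= d by rewrite ler_piMr // ltW.
have [t tE] : exists t : R, t = s - 3 / 4 * d + 3 / 4 * (d * (2^-1 * p)) by eexists.
have [sg sgE] : exists sg : R, sg = d * p / 16 by eexists.
have [tau tauE] : exists tau : R, tau = d * p / 4 by eexists.
have tE1 : s - 3 / 4 * d + d / 2 * p = t + 2 * sg by rewrite tE sgE; field.
have tE2 : s - 3 / 4 * d + 3 / 4 * (d * p) = t + 2 * sg + tau.
  by rewrite tE sgE tauE; field.
have tpos : t = s - 3 / 4 * d + 3 / 8 * (d * p) by rewrite tE; field.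
have t0 : 0 < t by rewrite tpos; lra.
have sg0 : 0 < sg by rewrite sgE; lra.
have tau0 : 0 < tau by rewrite tauE; lra.
have t1 : t + 2 * sg + tau < 1 by rewrite -tE2; lra.
have tauk : tau `^ k = d `^ k * q / 4 `^ k.
  by rewrite tauE powR_quarter ?ltW // powRM ?ltW // qE.
have [A AE] : exists A : R, A = N * 4 `^ k * eps / d `^ k * p ^+ 2 * q by eexists.
have A1 : A <= d / 64 * p ^+ 2.
  rewrite AE -mulrA; apply: ler_pM => //.
  - by apply: ltW; rewrite divr_gt0 // !mulr_gt0.
  - by apply: ltW; rewrite mulr_gt0 // exprn_gt0.
  - by rewrite ler_piMr ?exprn_ge0 // ltW.
have p21 : d * p ^+ 2 <= d * p by rewrite expr2 mulrA ler_piMr // ltW.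
have A1' : A <= 1 by lra.
rewrite tE2 in xin xle.
have xA : N / tau `^ k * sv_norm (t + 2 * sg + tau) (newton a j x n) <= A.
  have -> : A = N / tau `^ k * (eps * p ^+ 2 * q ^+ 2).
    by rewrite AE tauk; field; rewrite !gt_eqF.
  by apply: ler_wpM2l => //; rewrite divr_ge0 ?powR_ge0 // ltW.
have [] := newton_step hA hj hjk t0 sg0 tau0 t1 (ltW c0) xin xA A1'.
rewrite tE1 -tE => bj bx; split.
  by apply: sv_ball_le bj => //; lra.
apply: sv_ball_le bx => //; first by lra.
(* Of the two factors epsilon in c sigma^-1 A^2, one is absorbed by c N^2. *)
have cN : c * N ^+ 2 * eps = (d `^ k * d) ^+ 2 / ((4 `^ k) ^+ 3 * 256).
  by rewrite epsE; field; rewrite !gt_eqF.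
have -> : c * sg^-1 * A ^+ 2 = (c * N ^+ 2 * eps) *
    (16 * (4 `^ k) ^+ 2 * eps * p ^+ 3 * q ^+ 2 / (d * (d `^ k) ^+ 2)).
  by rewrite AE sgE; field; rewrite !gt_eqF.
have -> : c * N ^+ 2 * eps *
    (16 * (4 `^ k) ^+ 2 * eps * p ^+ 3 * q ^+ 2 / (d * (d `^ k) ^+ 2)) =
    eps * (2^-1 * p) ^+ 2 * (q ^+ 2 / 4 `^ k) * (d * p / 4).
  by rewrite cN; field; rewrite !gt_eqF.
rewrite qq ler_piMr //; last by lra.
by rewrite !mulr_ge0 ?exprn_ge0 ?invr_ge0 // ?mulr_ge0 ?ltW.
Qed.

End NewtonIteration.

(** * Local homogeneity *)

(** If N(j) = 0 then j vanishes, and so does id = rho o j. *)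
Lemma kN_eq0_trivial (R : realType) (G : scaledGroup R) (E : scaledVect R)
    (a : scaledAction G E) (k : R) (j : {linear E -> sg_lie G}) :
  cancel j (fun xi : sg_lie G => inf_act a xi 0) -> k_bounded k j ->
  kN k j = 0 -> forall x : E, x = 0.
Proof.
move=> hj hjk N0 x.
have [t /andP[t0 t1] xt] := sv_cover x.
have tE : t / 2 + t / 2 = t by field.
have t20 : 0 < t / 2 by lra.
have t21 : t / 2 + t / 2 < 1 by lra.
have ht2 : 0 < t / 2 < 1 by apply/andP; split; lra.
have xt2 : sv_in (t / 2 + t / 2) x by rewrite tE.
have jx_in := hjk.1 _ _ t20 t20 t21 _ xt2.
have := kN_bound hjk t20 t20 t21 xt2; rewrite N0 !mul0r => jx0.
have jx : j x = 0.
  apply: contraTeq jx0 => /(sv_norm_gt0 ht2 jx_in); by rewrite ltNge.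
by rewrite -[x]hj jx -(linear0 j) hj.
Qed.

(** The product of the Newton corrections converges at the scale s - 3 d / 4; the
remaining d / 4 exceeds the size d / 32 of its logarithm, which is what the action
needs to be continuous there. *)
Lemma ball_sub_orbit (R : realType) (G : scaledGroup R) (E : scaledVect R)
    (a : scaledAction G E) (c k : R) (j : {linear E -> sg_lie G}) (s d : R) :
  1 <= c -> cond_A a c -> 0 <= k ->
  cancel j (fun xi : sg_lie G => inf_act a xi 0) -> k_bounded k j ->
  s < 1 -> 0 < d -> d < s -> 0 < kN k j -> d <= 4 * kN k j `^ (k + 1)^-1 ->
  sv_ball E s (d `^ (2 * k + 2) / (4 `^ (3 * k + 4) * c * kN k j ^+ 2)) `<=`
  [set a (sg_exp xi) 0 | xi in sv_ball (sg_lie G) (s - d) 1].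
Proof.
move=> c1 hA k0 hj hjk s1 d0 ds N0 dN x hx.
have bounds := newton_bounds c1 hA k0 hj hjk s1 d0 ds N0 dN hx.
have r0 : 0 < s - 3 / 4 * d by lra.
have h0 : 0 < d / 2 by lra.
have rh1 : s - 3 / 4 * d + d / 2 < 1 by lra.
have [expS eta_ball [l l_ball eta_l]] :=
  log_prod_cvg (xi := j \o newton a j x) r0 h0 rh1 (fun n => (bounds n).2).
have sd0 : 0 < s - d by lra.
have d40 : 0 < d / 4 by lra.
have sd1 : s - d + d / 4 < 1 by lra.
have rE : s - d + d / 4 = s - 3 / 4 * d by field.
have scale_le n : s - 3 / 4 * d <= s - 3 / 4 * d + 3 / 4 * (d * 2^-1 ^+ n).
  by rewrite lerDl !mulr_ge0 // ?ltW ?half_pow_gt0 //; lra.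
have scale_lt1 n : s - 3 / 4 * d + 3 / 4 * (d * 2^-1 ^+ n) < 1.
  have : d * 2^-1 ^+ n <= d by rewrite ler_piMr ?half_pow_le1 // ltW.
  lra.
have squeeze0 (u v : nat -> R) : (forall n, 0 <= u n) -> (forall n, u n <= v n) ->
    v n @[n --> \oo] --> 0 -> u n @[n --> \oo] --> 0.
  move=> u0 uv v0; apply: (@squeeze_cvgr _ _ _ _ (fun=> 0) v) => //.
    by apply: nearW => n; rewrite u0 uv.
  exact: cvg_cst.
exists l; first by apply: sv_ball_le l_ball => //; lra.
apply: (act_limit (eta := log_prod (j \o newton a j x))
  (y := fun n => newton a j x n.+1) sd0 d40 sd1).
- by move=> n; apply: sv_ball_le (eta_ball n) => //; lra.
- by apply: sv_ball_le l_ball => //; lra.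
- by move=> n; rewrite rE; exact: sv_in_le r0 (scale_le _) (scale_lt1 _) (bounds n.+1).1.1.
- exact: sv_in0.
- apply: squeeze0 eta_l => n; first exact: sv_norm_ge0.
  apply: sv_norm_le; [lra|lra|lra|].
  by apply: sv_inB; [case: (eta_ball n)|case: l_ball].
- set eps := d `^ _ / _ in bounds.
  apply: (squeeze0 _ (geometric eps 2^-1)) => [n|n|].
  + exact: sv_norm_ge0.
  + rewrite subr0 rE.
    have [yin yle] := (bounds n.+1).1.
    apply: le_trans (sv_norm_le r0 (scale_le _) (scale_lt1 _) yin) _.
    apply: le_trans yle _.
    have eps0 : 0 <= eps by rewrite divr_ge0 ?mulr_ge0 ?powR_ge0 ?exprn_ge0 // ltW; lra.
    rewrite /= -mulrA; apply: ler_wpM2l => //.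
    have p0 := half_pow_gt0 (R := R) n.
    have p'1 := half_pow_le1 (R := R) n.+1; have p'0 := half_pow_gt0 (R := R) n.+1.
    have : (2^-1 ^+ n.+1) `^ k <= 1 :> R.
      by have := ge0_ler_powR k0 (ltW p'0) ler01 p'1; rewrite powR1; apply; rewrite nnegrE ltW.
    move=> w1; rewrite -[leRHS]mulr1; apply: ler_pM; rewrite ?sqr_ge0 //.
      apply: (@le_trans _ _ (2^-1 ^+ n.+1)); first by rewrite expr2 ler_piMr // ltW.
      by rewrite exprS ler_piMl // ?ltW //; lra.
    by rewrite expr_le1 // powR_ge0.
  + by apply: cvg_geometric; rewrite ger0_norm; lra.
- by move=> n; exact: newton_act.
Qed.

Unset Implicit Arguments.
Set Strict Implicit.
Set Printing Implicit Defensive.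

Theorem mainTheorem1 (R : realType) (G : scaledGroup R) (E : scaledVect R)
  (a : scaledAction G E) (c : R) (hc : 1 <= c) (hA : cond_A a c)
  (k : R) (hk : 0 <= k) (j : {linear E -> sg_lie G})
  (hj : cancel j (fun xi : sg_lie G => inf_act a xi 0))
  (hjk : k_bounded k j) :
  locally_homogeneous a /\
  forall s delta : R, 0 < s < 1 -> 0 < delta < s ->
    delta <= 4 * kN k j `^ (k + 1)^-1 ->
    let eps := delta `^ (2 * k + 2) / (4 `^ (3 * k + 4) * c * kN k j ^+ 2) in
    sv_ball E s eps `<=`
      [set a (sg_exp xi) 0 | xi in sv_ball (sg_lie G) (s - delta) 1].
Proof.
have k1 : k + 1 != 0 by rewrite gt_eqF; lra.
have N_ge0 := kN_ge0 hjk.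
split=> [s /andP[s0 s1]|s d /andP[s0 s1] /andP[d0 ds] dN].
  (* When N(j) = 0, the radius given by the formula is 0, and E is trivial. *)
  have [N0|N0] := eqVneq (kN k j) 0.
    exists 1 => // x _; exists 1%g => //.
    by rewrite sa_act1 (kN_eq0_trivial hj hjk N0 x).
  have {N_ge0}N0 : 0 < kN k j by rewrite lt_def N0.
  have root0 : 0 < 4 * kN k j `^ (k + 1)^-1 by rewrite mulr_gt0 ?powR_gt0.
  pose d := Num.min (s / 2) (4 * kN k j `^ (k + 1)^-1).
  have d0 : 0 < d by rewrite lt_min root0 andbT; lra.
  have ds : d < s by rewrite gt_min; apply/orP; left; lra.
  have dN : d <= 4 * kN k j `^ (k + 1)^-1 by rewrite ge_min lexx orbT.
  eexists; last first.
    move=> x /(ball_sub_orbit hc hA hk hj hjk s1 d0 ds N0 dN)[xi _ <-].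
    by exists (sg_exp xi).
  by rewrite divr_gt0 ?powR_gt0 // !mulr_gt0 ?exprn_gt0 ?powR_gt0 //; lra.
(* When N(j) = 0, the bound on delta contradicts 0 < delta. *)
have [N0|N0] := eqVneq (kN k j) 0.
  by move: dN; rewrite N0 powR0 ?invr_neq0 // mulr0 leNgt d0.
by apply: (ball_sub_orbit hc hA) => //; rewrite lt_def N0.
Qed.
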